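(* Let $r\ge 1$ be an integer and let $\lambda,\mu,\nu\in\mathbb{C}$ be such that $\frac{2^\mu t^\nu}{\lambda e^t+1}$ has a power series expansion in $t$ at $t=0$. Then for each pair of positive integers $c,d$, all integers $n\ge 0$, all $m\in\mathbb{N}=\{1,2,\dots\}$ and all $x,y,X,Y\in\mathbb{C}$, the 2-variable truncated exponential Apostol type polynomials satisfy $$\sum_{k=0}^n\binom{n}{k}\sum_{i=0}^{c-1}\sum_{j=0}^{d-1}(-1)^{i+j}\lambda^{i+j}c^k d^{n-k}\,{}_{e^{(r)}}\mathcal{F}_k^{(m)}\Big(dx+\frac{d}{c}i,d^{r}y;\lambda;\mu,\nu\Big)\,{}_{e^{(r)}}\mathcal{F}_{n-k}^{(m)}\Big(cX+\frac{c}{d}j,c^{r}Y;\lambda;\mu,\nu\Big)$$ $$=\sum_{k=0}^n\binom{n}{k}\sum_{i=0}^{d-1}\sum_{j=0}^{c-1}(-1)^{i+j}\lambda^{i+j}d^k c^{n-k}\,{}_{e^{(r)}}\mathcal{F}_k^{(m)}\Big(cx+\frac{c}{d}i,c^{r}y;\lambda;\mu,\nu\Big)\,{}_{e^{(r)}}\mathcal{F}_{n-k}^{(m)}\Big(dX+\frac{d}{c}j,d^{r}Y;\lambda;\mu,\nu\Big).$$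
   Context: For an integer $m\ge 0$, the 2-variable truncated exponential Apostol type polynomials ${}_{e^{(r)}}\mathcal{F}_n^{(m)}(x,y;\lambda;\mu,\nu)$ of order $m$ are defined by the generating function (an identity of power series in $t$) $$\Big(\frac{2^\mu t^\nu}{\lambda e^{t}+1}\Big)^m \frac{e^{xt}}{1-yt^r}=\sum_{n=0}^{\infty}{}_{e^{(r)}}\mathcal{F}_n^{(m)}(x,y;\lambda;\mu,\nu)\frac{t^{n}}{n!}.$$ The base factor has a power series expansion exactly when $\nu$ is a nonnegative integer and, in the case $\lambda=-1$, $\nu\ge 1$. Here $2^\mu=e^{\mu\log 2}$, and $\lambda^0=1$. *)

(* Defs.v *)
From mathcomp Require Export all_boot all_order all_algebra.
From mathcomp Require Export all_classical all_reals all_analysis.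
From mathcomp Require Export complex.
Export Order.TTheory GRing.Theory Num.Theory numFieldNormedType.Exports.

Set Implicit Arguments.
Unset Strict Implicit.
Unset Printing Implicit Defensive.

Local Open Scope classical_set_scope.
Local Open Scope complex_scope.
Local Open Scope ring_scope.

(* The complex numbers are [R[i]] with [R : realType]; the complex exponential
   is not in the libraries. *)
Definition expC (R : realType) (z : R[i]) : R[i] :=
  (expR (complex.Re z))%:C * (cos (complex.Im z) +i* sin (complex.Im z)).

(* [2^mu t^nu / (lambda e^t + 1)] at a real [t > 0]. Powers of a positive real
   [s] are [s^z = e^(z ln s)], so no choice of branch is involved. *)
Definition base_fun (R : realType) (lambda mu nu : R[i]) (t : R) : R[i] :=
  expC (mu * (ln 2)%:C) * expC (nu * (ln t)%:C) / (lambda * expC t%:C + 1).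

(* [f] is the sum of the power series with coefficients [a] near [0]. Only small
   positive [t] are tested: convergence there gives a positive radius of
   convergence over the complex numbers, the values there determine [a], and
   off the positive axis [t^nu] is multivalued when [nu] is not an integer.
   The cast to [numFieldType] selects the topology of the norm of [R[i]]. *)
Definition has_expansion (R : realType) (f : R -> R[i]) (a : nat -> R[i]) : Prop :=
  \forall t \near 0^'+,
    [series a k * t%:C ^+ k]_k @ \oo --> (f t : (R[i] : numFieldType)).

Definition expandable (R : realType) (f : R -> R[i]) : Prop :=
  exists a, has_expansion f a.

(* The coefficients of the (unique) expansion of [f], [0] if there is none. *)
Definition coefs (R : realType) (f : R -> R[i]) : nat -> R[i] :=
  xget (fun=> 0) [set a | has_expansion f a].

(* Formal power series in [t], given by their sequences of coefficients. *)
Section PowerSeries.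
Variable K : fieldType.
Implicit Types a b : nat -> K.

Definition ps1 : nat -> K := fun n => (n == 0%N)%:R.

Definition ps_mul a b : nat -> K := fun n => \sum_(i < n.+1) a i * b (n - i)%N.

Definition ps_exp a m : nat -> K := iter m (ps_mul a) ps1.

(* [e^(x t)] *)
Definition ps_expX (x : K) : nat -> K := fun n => x ^+ n / n`!%:R.

(* [1 / (1 - y t^r) = \sum_k y^k t^(r k)], for [0 < r] *)
Definition ps_geom (r : nat) (y : K) : nat -> K :=
  fun n => if (r %| n)%N then y ^+ (n %/ r) else 0.

End PowerSeries.

(* The polynomial of index [n] and order [m], i.e. [n!] times the coefficient of
   [t^n] in [(2^mu t^nu / (lambda e^t + 1))^m * e^(x t) / (1 - y t^r)]. *)
Definition apostolF (R : realType) (r : nat) (lambda mu nu : R[i])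
    (m n : nat) (x y : R[i]) : R[i] :=
  n`!%:R *
  ps_mul (ps_mul (ps_exp (coefs (base_fun lambda mu nu)) m) (ps_expX x))
         (ps_geom r y) n.

(* Main.v *)
From HB Require Import structures.
Require Import Defs.
From mathcomp Require Import ring.

(** Writing [A(t)] for the [m]-th power of the base series, the [(i, j)] term on
    the left is [n!] times the coefficient of [t^n] in
      [A(c t) A(d t) (-lambda)^(i+j) e^((c d (x + X) + d i + c j) t)
         / ((1 - (c d)^r y t^r) (1 - (c d)^r Y t^r))],
    which is also the [(j, i)] term on the right. *)

Local Open Scope ring_scope.

Section PowerSeriesTheory.
Local Set Implicit Arguments.
Local Unset Strict Implicit.
Variable K : fieldType.
Implicit Types (a b e : nat -> K) (s u v : K).

(** Coefficients of a product up to degree [N] involve only those of the factors up to [N], so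
    series can be traded for polynomial truncations; the laws of [ps_mul] then come from those of
    [{poly K}]. *)
Lemma coef_poly_ps_mul (N : nat) (p q : {poly K}) a b :
    (forall k, (k <= N)%N -> p`_k = a k) ->
    (forall k, (k <= N)%N -> q`_k = b k) ->
  forall k, (k <= N)%N -> (p * q)`_k = ps_mul a b k.
Proof.
move=> pa qb k kN; rewrite coefM; apply: eq_bigr => i _.
by rewrite pa ?qb //; apply: leq_trans kN; rewrite ?leq_subr // -ltnS.
Qed.

Definition ps_trunc (N : nat) a : {poly K} := \poly_(i < N.+1) a i.

Lemma coef_ps_trunc (N : nat) a k : (k <= N)%N -> (ps_trunc N a)`_k = a k.
Proof. by move=> kN; rewrite coef_poly ltnS kN. Qed.

Lemma ps_mulC : commutative (@ps_mul K).
Proof.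
move=> a b; apply/funext => n.
by rewrite -!(coef_poly_ps_mul (@coef_ps_trunc n _) (@coef_ps_trunc n _)) // mulrC.
Qed.

Lemma ps_mulA : associative (@ps_mul K).
Proof.
move=> a b e; apply/funext => n.
have T := @coef_ps_trunc n.
rewrite -(coef_poly_ps_mul (T a) (coef_poly_ps_mul (T b) (T e))) //.
by rewrite -(coef_poly_ps_mul (coef_poly_ps_mul (T a) (T b)) (T e)) // mulrA.
Qed.

(** Makes [Monoid.mulmACA] applicable to products of series. *)
HB.instance Definition _ :=
  SemiGroup.isComLaw.Build (nat -> K) (@ps_mul K) ps_mulA ps_mulC.

(* [a(s t)] *)
Definition ps_scale s a : nat -> K := fun n => s ^+ n * a n.

Lemma ps_scaleM s a b :
  ps_scale s (ps_mul a b) = ps_mul (ps_scale s a) (ps_scale s b).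
Proof.
apply/funext => n; rewrite /ps_scale /ps_mul mulr_sumr.
apply: eq_bigr => i _; rewrite mulrACA -exprD subnKC //.
by rewrite -ltnS.
Qed.

Lemma ps_scale_expX s u : ps_scale s (ps_expX u) = ps_expX (s * u).
Proof. by apply/funext => n; rewrite /ps_scale /ps_expX exprMn mulrA. Qed.

Lemma ps_scale_geom r s u : ps_scale s (ps_geom r u) = ps_geom r (s ^+ r * u).
Proof.
apply/funext => n; rewrite /ps_scale /ps_geom; case: ifP => [rn|]; last by rewrite mulr0.
by rewrite exprMn -exprM mulnC divnK.
Qed.

(** Here [A] abstracts the [m]-th power of the base series; for that choice the body is convertible
    to that of [apostolF]. *)
Definition appell (r : nat) A (n : nat) u v : K :=
  n`!%:R * ps_mul (ps_mul A (ps_expX u)) (ps_geom r v) n.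

End PowerSeriesTheory.

Lemma natr_bin_fact (K : numFieldType) (n k : nat) : (k <= n)%N ->
  'C(n, k)%:R * (k`!%:R * (n - k)`!%:R) = n`!%:R :> K.
Proof. by move=> kn; rewrite -!natrM bin_fact. Qed.

Lemma fact_neq0 (K : numFieldType) (n : nat) : n`!%:R != 0 :> K.
Proof. by rewrite pnatr_eq0 -lt0n fact_gt0. Qed.

Lemma ps_expXD (K : numFieldType) (u v : K) :
  ps_mul (ps_expX u) (ps_expX v) = ps_expX (u + v).
Proof.
(* [exprDn] puts the exponent [n - i] on the first summand, hence the swap by [addrC] to match the
   Cauchy product. *)
apply/funext => n; rewrite /ps_mul /ps_expX addrC exprDn mulr_suml.
apply: eq_bigr => i _; have le_in : (i <= n)%N by rewrite -ltnS.
rewrite -(natr_bin_fact K _ _ le_in) -mulr_natl.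
have bin0 : 'C(n, i)%:R != 0 :> K by rewrite pnatr_eq0 -lt0n bin_gt0.
by field; rewrite !fact_neq0 bin0.
Qed.

(** Binomial convolution is the product of exponential generating functions; the weights [c ^+ k]
    and [d ^+ (n - k)] come from substituting [c t] and [d t] for [t]. *)
Lemma ps_exponential_coef_mul (K : numFieldType) (c d : K) (a b : nat -> K) (n : nat) :
  \sum_(0 <= k < n.+1)
    'C(n, k)%:R * (c ^+ k * d ^+ (n - k) * (k`!%:R * a k) * ((n - k)`!%:R * b (n - k)%N))
  = n`!%:R * ps_mul (ps_scale c a) (ps_scale d b) n.
Proof.
rewrite big_mkord /ps_mul mulr_sumr; apply: eq_bigr => k _.
have le_kn : (k <= n)%N by rewrite -ltnS.
by rewrite -(natr_bin_fact K _ _ le_kn) /ps_scale; ring.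
Qed.

(** The two scaled exponentials merge, so [u] and [U] matter only through [c * u + d * U]. *)
Lemma appell_convolution (K : numFieldType) (r : nat) (A : nat -> K) (n : nat)
    (c d u v U V : K) :
  \sum_(0 <= k < n.+1) 'C(n, k)%:R *
    (c ^+ k * d ^+ (n - k) * appell r A k u v * appell r A (n - k) U V)
  = n`!%:R *
    ps_mul (ps_mul (ps_mul (ps_scale c A) (ps_scale d A)) (ps_expX (c * u + d * U)))
      (ps_mul (ps_geom r (c ^+ r * v)) (ps_geom r (d ^+ r * V))) n.
Proof.
rewrite ps_exponential_coef_mul !ps_scaleM !ps_scale_expX !ps_scale_geom.
(* The first regrouping collects the geometric factors, the second separates the copies of [A] from
   the exponentials. *)
by rewrite -ps_expXD [in LHS]Monoid.mulmACA [X in _ * ps_mul X _ _ = _]Monoid.mulmACA.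
Qed.

Lemma exchange_big_sum_product (K : comPzRingType) (c d n : nat) (w : nat -> K)
    (g : nat -> nat -> nat -> K) :
  \sum_(0 <= k < n) w k * \sum_(0 <= i < c) \sum_(0 <= j < d) g k i j =
  \sum_(0 <= i < c) \sum_(0 <= j < d) \sum_(0 <= k < n) w k * g k i j.
Proof.
under eq_bigr do rewrite mulr_sumr.
rewrite exchange_big /=; apply: eq_bigr => i _.
under eq_bigr do rewrite mulr_sumr.
by rewrite exchange_big.
Qed.

Lemma appell_symmetry (K : numFieldType) (r : nat) (A : nat -> K) (lambda : K)
    (c d : nat) (c_gt0 : (0 < c)%N) (d_gt0 : (0 < d)%N) (n : nat) (x y X Y : K) :
  let F k u v := appell r A k u v in
  \sum_(0 <= k < n.+1) 'C(n, k)%:R *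
    \sum_(0 <= i < c) \sum_(0 <= j < d)
      (-1) ^+ (i + j) * lambda ^+ (i + j) * c%:R ^+ k * d%:R ^+ (n - k) *
      F k (d%:R * x + d%:R / c%:R * i%:R) (d%:R ^+ r * y) *
      F (n - k)%N (c%:R * X + c%:R / d%:R * j%:R) (c%:R ^+ r * Y)
  =
  \sum_(0 <= k < n.+1) 'C(n, k)%:R *
    \sum_(0 <= i < d) \sum_(0 <= j < c)
      (-1) ^+ (i + j) * lambda ^+ (i + j) * d%:R ^+ k * c%:R ^+ (n - k) *
      F k (c%:R * x + c%:R / d%:R * i%:R) (c%:R ^+ r * y) *
      F (n - k)%N (d%:R * X + d%:R / c%:R * j%:R) (d%:R ^+ r * Y).
Proof.
move=> F; have nz k : (0 < k)%N -> k%:R != 0 :> K by rewrite pnatr_eq0 -lt0n.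
have c0 := nz _ c_gt0; have d0 := nz _ d_gt0.
(* With the sums over [k] innermost, swapping the outer sums on the right makes its [(j, i)] term
   face the [(i, j)] term on the left. *)
rewrite !exchange_big_sum_product [in RHS]exchange_big /=.
apply: eq_bigr => i _; apply: eq_bigr => j _.
(* The sign and the power of [lambda] are constant in [k]; without them the sum fits
   [appell_convolution]. *)
have pull (a b : K) u v U V :
    \sum_(0 <= k < n.+1) 'C(n, k)%:R *
      ((-1) ^+ (i + j) * lambda ^+ (i + j) * a ^+ k * b ^+ (n - k) *
       F k u v * F (n - k)%N U V) =
    (-1) ^+ (i + j) * lambda ^+ (i + j) *
    \sum_(0 <= k < n.+1) 'C(n, k)%:R *
      (a ^+ k * b ^+ (n - k) * F k u v * F (n - k)%N U V).
  by rewrite mulr_sumr; apply: eq_bigr => k _; ring.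
rewrite (addnC j i) !pull !appell_convolution.
congr (_ * (_ * ps_mul (ps_mul _ (ps_expX _)) (ps_mul (ps_geom r _) (ps_geom r _)) n)).
- exact: ps_mulC.
(* The outer scalings cancel the denominators of [d / c] and [c / d], leaving [d i + c j] on both
   sides. *)
- by field; rewrite c0 d0.
- by rewrite mulrCA.
- by rewrite mulrCA.
Qed.

Theorem corollary3p6 (R : realType) (r : nat) (lambda mu nu : complex R)
    (r_ge1 : (1 <= r)%N)
    (base_expandable : expandable (base_fun lambda mu nu))
    (c d : nat) (c_gt0 : (0 < c)%N) (d_gt0 : (0 < d)%N)
    (n m : nat) (m_ge1 : (1 <= m)%N)
    (x y X Y : complex R) :
  let F k u v := apostolF r lambda mu nu m k u v in
  \sum_(0 <= k < n.+1) 'C(n, k)%:R *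
    \sum_(0 <= i < c) \sum_(0 <= j < d)
      (-1) ^+ (i + j) * lambda ^+ (i + j) * c%:R ^+ k * d%:R ^+ (n - k) *
      F k (d%:R * x + d%:R / c%:R * i%:R) (d%:R ^+ r * y) *
      F (n - k)%N (c%:R * X + c%:R / d%:R * j%:R) (c%:R ^+ r * Y)
  =
  \sum_(0 <= k < n.+1) 'C(n, k)%:R *
    \sum_(0 <= i < d) \sum_(0 <= j < c)
      (-1) ^+ (i + j) * lambda ^+ (i + j) * d%:R ^+ k * c%:R ^+ (n - k) *
      F k (c%:R * x + c%:R / d%:R * i%:R) (c%:R ^+ r * y) *
      F (n - k)%N (d%:R * X + d%:R / c%:R * j%:R) (d%:R ^+ r * Y).
Proof.
exact: (appell_symmetry _ r (ps_exp (coefs (base_fun lambda mu nu)) m)).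
Qed.
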